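(* Consider the class of all proper bimonotone functions $f\colon\mathbb{N}\times\mathbb{N}\to\mathbb{Q}$, and let $m$ denote the length of the priority queue built up by the semimonotone enumeration algorithm (described in the context) while enumerating the first $n$ values of $f$. The semimonotone enumeration algorithm guarantees the memory bound $m \le n+1$, and as a uniform bound (for all functions in the class) the exponent $1$ of $n$ is best possible: enumerating the values of $f(a,b) = a^\alpha + a^\alpha b^\beta + b^\beta$ with positive integers $\alpha < \beta$ requires memory $m \in \Theta(n^{\alpha/\beta})$.
   Context: $\mathbb{N}=\{0,1,2,\dots\}$. A function $f\colon\mathbb{N}\times\mathbb{N}\to\mathbb{Q}$ is bimonotone if $a\le a'$ and $b\le b'$ imply $f(a,b)\le f(a',b')$; it is proper if for every $z\in\operatorname{Im}(f)$ only finitely many pairs $(a,b)$ satisfy $f(a,b)\le z$. The $\Theta$-statement is asymptotic for $n\to\infty$ with $\alpha,\beta$ fixed. Semimonotone enumeration algorithm (for $A=B=\mathbb{N}$, $a_{\min}=b_{\min}=0$, successor $\sigma x=x+1$). Write $f^*(a,b)=(f(a,b),a,b)$; $F$ is a priority queue of such triples sorted by first coordinate. (1) Initialize $F=\langle f^*(a_{\min},b_{\min})\rangle$ and set $b_{\max}:=b_{\min}$. (2) While $F$ is non-empty: remove a minimal element $f^*(a,b)$ from $F$ and output $(a,b)$ (among several minimal ones, choose the one with minimal $b$); insert $f^*(\sigma a,b)$ into $F$; if $b=b_{\max}$, then set $b_{\max}:=\sigma b_{\max}$ and insert $f^*(a_{\min},b_{\max})$ into $F$. *)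

(* Defs.v *)
From mathcomp Require Import all_boot all_order all_algebra.
From mathcomp Require Import all_classical all_reals all_analysis.
Import Order.TTheory GRing.Theory Num.Theory.
Import numFieldNormedType.Exports.

Set Implicit Arguments.
Unset Strict Implicit.
Unset Printing Implicit Defensive.

Local Open Scope classical_set_scope.
Local Open Scope ring_scope.

Definition bimonotone (f : nat * nat -> rat) : Prop :=
  forall a a' b b' : nat,
    (a <= a')%N -> (b <= b')%N -> f (a, b) <= f (a', b').

Definition proper_fun (f : nat * nat -> rat) : Prop :=
  forall z : rat, range f z -> finite_set [set ab | f ab <= z].

(* (z, (a, b)) stands for the triple (f(a, b), a, b). *)
Definition entry : Type := (rat * (nat * nat))%type.

(* Ordered by value; ties are broken in favour of the smaller b. *)
Definition entry_le (x y : entry) : bool :=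
  (x.1 < y.1) || (x.1 == y.1) && (x.2.2 <= y.2.2)%N.

Definition fstar (f : nat * nat -> rat) (a b : nat) : entry :=
  (f (a, b), (a, b)).

(* A priority queue is a list kept sorted by entry_le, so that its head is the
   entry to be removed next. *)
Definition insert (x : entry) (F : seq entry) : seq entry :=
  merge entry_le [:: x] F.

(* The pairs output so far are listed in the order of their output. *)
Record state : Type := State {
  queue : seq entry;
  bmax : nat;
  output : seq (nat * nat)
}.

Definition init_state (f : nat * nat -> rat) : state :=
  State [:: fstar f 0 0] 0 [::].

(* One pass through the body of the loop; the state is left unchanged when the
   loop has terminated. *)
Definition step (f : nat * nat -> rat) (s : state) : state :=
  if queue s is (_, (a, b)) :: F then
    let F1 := insert (fstar f a.+1 b) F in
    let out := rcons (output s) (a, b) in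
    if b == bmax s then
      State (insert (fstar f 0 (bmax s).+1) F1) (bmax s).+1 out
    else State F1 (bmax s) out
  else s.

(* Every pass outputs exactly one pair, so n passes enumerate n values. *)
Definition enumerate (f : nat * nat -> rat) (n : nat) : state :=
  iter n (step f) (init_state f).

(* No pass shortens the queue, so this is also the maximal length reached during
   the enumeration of the first n values. *)
Definition queue_length (f : nat * nat -> rat) (n : nat) : nat :=
  size (queue (enumerate f n)).

Definition power_fun (alpha beta : nat) (ab : nat * nat) : rat :=
  let: (a, b) := ab in
  a%:R ^+ alpha + a%:R ^+ alpha * b%:R ^+ beta + b%:R ^+ beta.

(* Main.v *)
Require Import Defs.
From mathcomp Require Import all_boot all_order all_algebra.
From mathcomp Require Import all_classical all_reals all_analysis.
From mathcomp Require Import zify ring lra.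
Import Order.TTheory GRing.Theory Num.Theory.
Import numFieldNormedType.Exports.
Local Open Scope classical_set_scope.
Local Open Scope ring_scope.

(* The queue always holds exactly one pair per column [b <= bmax], so its length
   is [bmax + 1], and a column is opened only when the previous one yields its
   first output; this gives [m <= n + 1].  By bimonotonicity every value output
   so far is at most every value in the queue.  For the power function, write
   [B = bmax], [s = beta / alpha > 1], and let [c b] be the number of outputs
   from column [b].  Comparing the output [(0, B - 1)] with the queue entry
   [(c 0, 0)] gives [(B - 1)^beta <= n^alpha].  Comparing the outputs of column
   [b] with the queue entry [(0, B)] gives [c b <= 1 + (2B / (b + 1))^s], and
   summing over [b < B], with [s > 1], gives [n <= K (B + 1)^s].  The exponents
   [k / (k + 1)] then exclude every uniform bound [n^gamma] with [gamma < 1]. *)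

(** * The order on queue entries *)

Lemma entry_le_total : total entry_le.
Proof.
move=> [x [a b]] [y [c d]]; rewrite /entry_le /=.
by case: (ltgtP x y) => //= _; exact: leq_total.
Qed.

Lemma entry_le_trans : transitive entry_le.
Proof.
move=> [y [c d]] [x [a b]] [z [e g]]; rewrite /entry_le /=.
move=> /orP[xy|/andP[/eqP -> bd]] /orP[yz|/andP[/eqP <- dg]].
- by rewrite (lt_trans xy yz).
- by rewrite xy.
- by rewrite yz.
- by rewrite eqxx (leq_trans bd dg) orbT.
Qed.

Lemma entry_le_fst (x y : entry) : entry_le x y -> x.1 <= y.1.
Proof. by case/orP => [/ltW//|/andP[/eqP ->]]. Qed.

Lemma insert_sorted (x : entry) (F : seq entry) :
  sorted entry_le F -> sorted entry_le (insert x F).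
Proof. by move=> sF; apply: (merge_sorted entry_le_total). Qed.

Lemma perm_insert (x : entry) (F : seq entry) : perm_eq (insert x F) (x :: F).
Proof. by rewrite /insert perm_merge. Qed.

(** * The loop invariant and the bound [n + 1] *)

(* [c b] counts the pairs output so far in the column [b]. *)
Definition queue_invariant (f : nat * nat -> rat) (n : nat) (s : state)
    (c : nat -> nat) : Prop :=
  [/\ sorted entry_le (queue s),
      perm_eq (queue s) [seq fstar f (c b) b | b <- iota 0 (bmax s).+1],
      forall b, (0 < c b)%N = (b < bmax s)%N,
      (\sum_(b < bmax s) c b = n)%N &
      forall a b b', (a < c b)%N -> (b' <= bmax s)%N ->
        f (a, b) <= f (c b', b')].

(** A pass replaces the entry of one column [b] by its successor there, so only [c b] changes, by
    one. The removed value is a minimum of the queue, and by bimonotonicity the entries only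
    grow. *)
Lemma step_invariant (f : nat * nat -> rat) (n : nat) (s : state)
    (c : nat -> nat) :
  bimonotone f -> queue_invariant f n s c ->
  exists c', queue_invariant f n.+1 (step f s) c'.
Proof.
case: s => Q B out fmon [].
rewrite [queue _]/= [bmax _]/= => sQ pQ cB sumc fle.
case: Q sQ pQ => [|[v [a b]] F] sQ pQ; first by move/perm_size: pQ.
have memQ b' : (b' <= B)%N -> fstar f (c b') b' \in (v, (a, b)) :: F.
  move=> b'B; rewrite (perm_mem pQ).
  by apply: (map_f (fun b => fstar f (c b) b)); rewrite mem_iota.
have [bB ac vE] : [/\ (b <= B)%N, a = c b & v = f (c b, b)].
  have : (v, (a, b)) \in (v, (a, b)) :: F by rewrite inE eqxx.
  rewrite (perm_mem pQ) => /mapP[x]; rewrite mem_iota add0n ltnS => /andP[_ xB].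
  by case=> -> -> ->.
subst a v.
have headle b' : (b' <= B)%N -> f (c b, b) <= f (c b', b').
  move=> b'B; have := memQ _ b'B; rewrite inE => /orP[/eqP[_ -> -> //]|inF].
  by have /entry_le_fst := allP (order_path_min entry_le_trans sQ) _ inF.
pose c' x := if x == b then (c b).+1 else c x.
have c'b : c' b = (c b).+1 by rewrite /c' eqxx.
have cc' x : (c x <= c' x)%N by rewrite /c'; case: eqP => [->|].
have sF : sorted entry_le F by move: sQ => /= /path_sorted.
have pF : perm_eq (fstar f (c b).+1 b :: F)
                  [seq fstar f (c' x) x | x <- iota 0 B.+1].
  have bi : b \in iota 0 B.+1 by rewrite mem_iota.
  have pi := perm_to_rem bi.
  rewrite perm_sym (permPl (perm_map _ pi)) /= c'b perm_cons perm_sym.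
  have -> : [seq fstar f (c' x) x | x <- rem b (iota 0 B.+1)] =
            [seq fstar f (c x) x | x <- rem b (iota 0 B.+1)].
    apply/eq_in_map => x; rewrite mem_rem_uniq ?iota_uniq// inE => /andP[xb _].
    by rewrite /c' (negbTE xb).
  by move: pQ; rewrite (permPr (perm_map _ pi)) /= perm_cons.
(* Old outputs are covered by [fle], the new one by minimality of the head; [mon] then passes to the
   new entries. *)
have outle x y b' : (x < c' y)%N -> (b' <= B)%N -> f (x, y) <= f (c b', b').
  move=> xy b'B; have [xy'|] := ltnP x (c y); first exact: fle.
  move: xy; rewrite /c'; case: eqP => [->|_].
  2: by move=> /leq_trans h /h; rewrite ltnn.
  rewrite ltnS => h1 h2; have -> : x = c b by apply/eqP; rewrite eqn_leq h1.
  exact: headle.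
have mon b' : f (c b', b') <= f (c' b', b') by apply: fmon.
have cB0 : c B = 0%N by apply/eqP; rewrite -leqn0 leqNgt cB ltnn.
(* Including column [B] serves both cases: it is the full range if [b = B], and otherwise its last
   term is [0]. *)
have sumB : (\sum_(x < B.+1) c' x = n.+1)%N.
  transitivity (\sum_(x < B.+1) (c x + (x == b :> nat)))%N.
    by apply: eq_bigr => x _; rewrite /c'; case: eqP => [->|]; rewrite ?addn1 ?addn0.
  rewrite big_split /= big_ord_recr /= sumc cB0 addn0 -[n.+1]addn1; congr addn.
  rewrite (bigD1 (Ordinal (bB : (b < B.+1)%N))) //= eqxx big1 // => x.
  by rewrite -val_eqE /= => /negbTE ->.
exists c'; rewrite /step /=; case: eqP => [bE|bE]; split; rewrite ?[queue _]/= ?[bmax _]/=.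
- by do 2! apply: insert_sorted.
- rewrite (permPl (perm_insert _ _)).
  have -> : iota 0 B.+2 = rcons (iota 0 B.+1) B.+1.
    by rewrite -[B.+2]addn1 iotaD cats1.
  rewrite map_rcons perm_sym perm_rcons.
  have -> : c' B.+1 = 0%N.
    rewrite /c' bE eqn_leq ltnn /=.
    by apply/eqP; rewrite -leqn0 leqNgt cB -leqNgt leqnSn.
  by rewrite perm_cons perm_sym (permPl (perm_insert _ _)).
- move=> x; rewrite /c'; case: eqP => [->|/eqP xb]; rewrite ?bE ?ltnSn//.
  by rewrite cB ltnS [RHS]leq_eqVlt -bE (negbTE xb).
- exact: sumB.
(* The fresh entry [(0, B + 1)] dominates the old entry [(0, B)], which is present because
   [c B = 0]. *)
- move=> x y b' xy; rewrite leq_eqVlt => /orP[/eqP ->|b'B].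
    apply: (le_trans (outle x y B xy (leqnn _))); apply: fmon => //.
    by rewrite cB0.
  exact: le_trans (outle _ _ _ xy b'B) (mon _).
- exact: insert_sorted.
- by rewrite (permPl (perm_insert _ _)).
- move=> x; rewrite /c'; case: eqP => [->|_]; last exact: cB.
  by apply/esym; rewrite ltn_neqAle bB andbT; apply/eqP.
- have c'B : c' B = 0%N.
    by rewrite /c'; case: eqP => [/esym//|_].
  by move: sumB; rewrite big_ord_recr /= c'B addn0.
- by move=> x y b' xy b'B; exact: le_trans (outle _ _ _ xy b'B) (mon _).
Qed.

Lemma enumerate_invariant (f : nat * nat -> rat) (n : nat) :
  bimonotone f -> exists c, queue_invariant f n (enumerate f n) c.
Proof.
move=> fmon; elim: n => [|n [c inv]].
  by exists (fun=> 0%N); split => //=; rewrite big_ord0.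
by rewrite /enumerate iterS; exact: step_invariant inv.
Qed.

Lemma queue_lengthE (f : nat * nat -> rat) (n : nat) :
  bimonotone f -> queue_length f n = (bmax (enumerate f n)).+1.
Proof.
move=> /(enumerate_invariant f n)[c [_ pQ _ _ _]].
by rewrite /queue_length (perm_size pQ) size_map size_iota.
Qed.

Lemma queue_length_leS (f : nat * nat -> rat) (n : nat) :
  bimonotone f -> (queue_length f n <= n.+1)%N.
Proof.
move=> fmon; rewrite queue_lengthE// ltnS.
have [c [_ _ cB sumc _]] := enumerate_invariant f n fmon.
rewrite -[leqRHS]sumc -[leqLHS]card_ord -sum1_card.
by apply: leq_sum => b _; rewrite cB.
Qed.

(** * Membership of the power functions in the class *)

Lemma power_fun_nat (alpha beta a b : nat) :
  power_fun alpha beta (a, b) = (a ^ alpha + a ^ alpha * b ^ beta + b ^ beta)%N%:R.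
Proof. by rewrite /power_fun !natrD natrM !natrX. Qed.

Lemma power_fun_bimonotone (alpha beta : nat) : bimonotone (power_fun alpha beta).
Proof.
move=> a a' b b' aa' bb'; rewrite !power_fun_nat ler_nat.
have leX x y k : (x <= y)%N -> (x ^ k <= y ^ k)%N.
  by case: k => // k xy; rewrite leq_exp2r.
by rewrite !leq_add ?leq_mul ?leX.
Qed.

(** Positive exponents give [a <= a ^ alpha] and [b <= b ^ beta], so a sublevel set lies in a finite
    square. *)
Lemma power_fun_proper (alpha beta : nat) :
  (0 < alpha)%N -> (0 < beta)%N -> proper_fun (power_fun alpha beta).
Proof.
move=> alpha0 beta0 _ [[c d] _ <-]; rewrite power_fun_nat.
set N := (X in X%:R).
apply: (@sub_finite_set _ _ (`I_N.+1 `*` `I_N.+1)); last first.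
  by apply: finite_setX; exact: finite_II.
move=> [a b] /= le_N; have {le_N} : power_fun alpha beta (a, b) <= N%:R by [].
rewrite power_fun_nat ler_nat => le_N.
have leX x k : (0 < k)%N -> (x <= x ^ k)%N.
  by case: x k => [//|x] [//|k] _; rewrite expnS leq_pmulr// expn_gt0.
have := leX a _ alpha0; have := leX b _ beta0; rewrite !ltnS; lia.
Qed.

(** * Real-analytic estimates *)

(** A discrete integral test: each term after the first is at most a difference of values of
    [x ^ (- r) / r], and these telescope. *)
Lemma sum_riemannR_le (R : realType) (r : R) (N : nat) : 0 < r ->
  \sum_(b < N) riemannR (1 + r) b <= 1 + r^-1.
Proof.
move=> r0.
have termle (k : nat) : riemannR (1 + r) k.+1 <=
    r^-1 * ((k.+1%:R `^ r)^-1 - (k.+2%:R `^ r)^-1).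
  rewrite /riemannR powRD ?pnatr_eq0 ?implybT// powRr1// invfM.
  rewrite [leRHS]mulrC ler_pdivlMr// lerBrDr.
  (* Bernoulli: [ln (1 - 1/(k+2)) <= -1/(k+2)], hence
     [((k+2)/(k+1))^r >= 1 + r/(k+2)]. *)
  have k1 : (0 : R) < k.+1%:R by rewrite ltr0n.
  have k2 : (0 : R) < k.+2%:R by rewrite ltr0n.
  have lnle : ln (k.+1%:R : R) - ln k.+2%:R <= - k.+2%:R^-1.
    rewrite -ln_div// (_ : k.+1%:R / k.+2%:R = 1 + - k.+2%:R^-1 :> R); last first.
      have -> : (k.+1%:R : R) = k.+2%:R - 1 by rewrite -[in RHS]natr1 addrK.
      by field; rewrite gt_eqF.
    by apply: le_ln1Dx; rewrite ltrN2 invf_lt1// ltr1n.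
  have : 1 + r / k.+2%:R <= k.+2%:R `^ r / k.+1%:R `^ r :> R.
    rewrite /powR !gt_eqF// -expRN -expRD.
    apply: le_trans (expR_ge1Dx _); rewrite lerD2l -mulrBr ler_pM2l//.
    by rewrite -lerN2 opprB.
  rewrite ler_pdivlMr ?powR_gt0// => h.
  rewrite -(ler_pM2l (powR_gt0 r k2)) mulrDr mulfV ?gt_eqF ?powR_gt0//.
  have := powR_gt0 r k1; have := powR_gt0 r k2.
  set x := (_ `^ _); set y := (_ `^ _) => x0 y0.
  have -> : x * (k.+2%:R^-1 / x * r) = r / k.+2%:R by field; rewrite !gt_eqF.
  by rewrite ler_pdivlMr// addrC.
(* The subtracted remainder is kept so that the induction on [M] goes through. *)
suff telescope M : \sum_(b < M.+1) riemannR (1 + r) b <=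
    1 + r^-1 * (1 - (M.+1%:R `^ r)^-1).
  case: N => [|N]; first by rewrite big_ord0 addr_ge0 ?invr_ge0 ?ltW.
  apply: (le_trans (telescope N)); rewrite lerD2l ler_piMr ?invr_ge0 ?ltW//.
elim: M => [|M IH].
  by rewrite big_ord_recr big_ord0 /= /riemannR powR1 invr1 subrr mulr0 add0r addr0.
rewrite big_ord_recr /=; apply: (le_trans (lerD IH (termle M))).
by rewrite -addrA lerD2l -mulrDr; rewrite ler_pM2l ?invr_gt0//; lra.
Qed.

Lemma le_powR_of_expr (R : realType) (x y : R) (p q : nat) :
  (0 < p)%N -> 0 <= x -> 0 <= y -> x ^+ p <= y ^+ q -> x <= y `^ (q%:R / p%:R).
Proof.
move=> p0 x0 y0 xy.
have -> : x = (x ^+ p) `^ p%:R^-1.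
  by rewrite -powR_mulrn// -powRrM mulfV ?powRr1// pnatr_eq0 -lt0n.
rewrite powRrM powR_mulrn//.
by apply: ge0_ler_powR => //; rewrite ?invr_ge0 ?nnegrE ?exprn_ge0.
Qed.

(** * Two-sided bounds for the power functions *)

Lemma queue_length_power_fun_le (R : realType) (alpha beta n : nat) :
  (0 < alpha)%N -> (0 < beta)%N ->
  (queue_length (power_fun alpha beta) n)%:R
    <= n%:R `^ (alpha%:R / beta%:R) + 2 :> R.
Proof.
move=> alpha0 beta0; have fmon := power_fun_bimonotone alpha beta.
rewrite queue_lengthE//.
have [c [_ _ cB sumc fle]] := enumerate_invariant _ n fmon.
(* In the successor case [bmax] is [B + 1] and the queue has [B + 2] entries, whence the summand
   [2]. *)
case: (bmax _) cB sumc fle => [|B] cB sumc fle.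
  by have := powR_ge0 (n%:R : R) (alpha%:R / beta%:R); lra.
suff : B%:R <= n%:R `^ (alpha%:R / beta%:R) :> R.
  by rewrite -[B.+2]addn2 natrD lerD2r.
apply: le_powR_of_expr => //; rewrite -!natrX ler_nat.
have c0n : (c 0 <= n)%N by rewrite -sumc big_ord_recl leq_addr.
apply: (@leq_trans (c 0 ^ alpha)%N); last by rewrite leq_exp2r.
have /fle/(_ (leq0n _)) : (0 < c B)%N by rewrite cB.
by rewrite !power_fun_nat ler_nat !exp0n// mul0n muln0 !add0n !addn0.
Qed.

(** The hypothesis gives [a ^ alpha * (1 + b ^ beta) <= B ^ beta]. Passing from [1 + b ^ beta] to
    [(b + 1) ^ beta] costs a factor [2 ^ beta]; then take roots of order [alpha]. *)
Lemma column_height_le (R : realType) (alpha beta a b B : nat) :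
  (0 < alpha)%N -> (0 < beta)%N ->
  power_fun alpha beta (a, b) <= power_fun alpha beta (0%N, B) ->
  a%:R <= (2 * B%:R) `^ (beta%:R / alpha%:R)
          * riemannR (beta%:R / alpha%:R) b :> R.
Proof.
move=> alpha0 beta0; rewrite !power_fun_nat ler_nat exp0n// mul0n !add0n => le_ab.
have bound : (a ^ alpha * b.+1 ^ beta <= (2 * B) ^ beta)%N.
  (* The [2] comes from [b + 1 <= 2 * b] for [b > 0]; the summand [1] covers [b = 0]. *)
  have b1 : (b.+1 ^ beta <= 2 ^ beta * (1 + b ^ beta))%N.
    case: b {le_ab} => [|b]; first by rewrite exp1n muln_gt0 expn_gt0.
    rewrite mulnDr -expnMn; apply: leq_trans (leq_addl _ _).
    by rewrite leq_exp2r// mul2n -addnn !addSn ltnS addnS ltnS leq_addl.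
  apply: (leq_trans (leq_mul (leqnn _) b1)).
  rewrite expnMn mulnCA leq_mul2l; apply/orP; right.
  by rewrite mulnDr muln1; apply: leq_trans le_ab; rewrite leq_addr.
have b1 : (0 : R) < b.+1%:R by rewrite ltr0n.
have -> : (2 * B%:R) `^ (beta%:R / alpha%:R) * riemannR (beta%:R / alpha%:R) b
    = (2 * B%:R / b.+1%:R) `^ (beta%:R / alpha%:R) :> R.
  rewrite [RHS]powRM ?mulr_ge0 ?invr_ge0//; congr (_ * _).
  by rewrite -(powR_inv1 (ltW b1)) -powRrM mulN1r powRN.
apply: le_powR_of_expr => //.
rewrite expr_div_n ler_pdivlMr ?exprn_gt0//.
by rewrite -natrM -!natrX -natrM ler_nat.
Qed.

Lemma queue_length_power_fun_ge (R : realType) (alpha beta : nat) :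
  (0 < alpha)%N -> (alpha < beta)%N ->
  exists2 K : R, 0 < K & forall n : nat, n%:R `^ (alpha%:R / beta%:R)
    <= K * (queue_length (power_fun alpha beta) n)%:R.
Proof.
move=> alpha0 alphabeta.
have beta0 : (0 < beta)%N by apply: leq_trans alphabeta.
have a0 : (0 : R) < alpha%:R by rewrite ltr0n.
have b0 : (0 : R) < beta%:R by rewrite ltr0n.
pose s : R := beta%:R / alpha%:R.
have s1 : 1 < s by rewrite /s ltr_pdivlMr// mul1r ltr_nat.
have s0 : 0 <= s by lra.
have r0 : 0 < s - 1 by lra.
pose Z : R := 1 + (s - 1)^-1.
have Z0 : 0 <= Z by rewrite addr_ge0 ?invr_ge0 ?ltW.
(* The [1] absorbs the summands [1] of the [B] column bounds; [Z] bounds the partial sums of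
   [riemannR s]. *)
pose K : R := 1 + 2 `^ s * Z.
have K0 : 0 < K by rewrite /K ltr_pwDl// mulr_ge0 ?powR_ge0.
(* This results from raising [n <= K * (B + 1) ^ s] to the power [alpha / beta], the inverse of
   [s]. *)
exists (K `^ (alpha%:R / beta%:R)); first exact: powR_gt0.
move=> n; have fmon := power_fun_bimonotone alpha beta.
rewrite queue_lengthE//.
have [c [_ _ cB sumc fle]] := enumerate_invariant _ n fmon.
set B := bmax _ in cB sumc fle *.
(* The summand [1] turns the index [c b - 1] of the last output of the column into a count. *)
have col (b : nat) : (b < B)%N ->
    (c b)%:R <= 1 + (2 * B%:R) `^ s * riemannR s b :> R.
  rewrite -cB; have cB0 : c B = 0%N by apply/eqP; rewrite -leqn0 leqNgt cB ltnn.
  case E : (c b) => [//|a] _; rewrite -natr1 addrC lerD2l.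
  apply: column_height_le => //.
  have := fle a b B; rewrite cB0; apply => //.
  by rewrite E.
have m1 : (1 : R) <= B.+1%:R by rewrite ler1n.
have nK : n%:R <= K * B.+1%:R `^ s.
  rewrite -sumc natr_sum.
  apply: (@le_trans _ _ (\sum_(b < B) (1 + (2 * B%:R) `^ s * riemannR s b))).
    by apply: ler_sum => b _; exact: col.
  rewrite big_split /= sumr_const card_ord -mulr_sumr /K [leRHS]mulrDl mul1r.
  apply: lerD.
    by apply: (@le_trans _ _ B.+1%:R); rewrite ?ler_nat ?le1r_powR// ltW.
  rewrite powRM// mulrAC; apply: ler_pM.
  - rewrite mulr_ge0 ?powR_ge0// sumr_ge0// => b _.
    by rewrite invr_ge0 powR_ge0.
  - exact: powR_ge0.
  - rewrite ler_wpM2l ?powR_ge0//.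
    by have := sum_riemannR_le _ _ B r0; rewrite addrC subrK.
  - by apply: ge0_ler_powR; rewrite ?nnegrE ?ler_nat.
have e0 : 0 <= alpha%:R / beta%:R :> R by rewrite divr_ge0.
apply: (@le_trans _ _ ((K * B.+1%:R `^ s) `^ (alpha%:R / beta%:R))).
  by apply: ge0_ler_powR; rewrite ?nnegrE ?mulr_ge0 ?powR_ge0 ?(ltW K0).
rewrite powRM ?powR_ge0 ?(ltW K0)// -powRrM.
have -> : s * (alpha%:R / beta%:R) = 1 by rewrite /s; field; rewrite !gt_eqF.
by rewrite powRr1.
Qed.

Lemma queue_length_power_fun_Theta (R : realType) (alpha beta : nat) :
  (0 < alpha)%N -> (alpha < beta)%N ->
  (fun n : nat => (queue_length (power_fun alpha beta) n)%:R : R)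
    \is 'Theta_\oo (fun n : nat => n%:R `^ (alpha%:R / beta%:R) : R).
Proof.
move=> alpha0 alphabeta.
have beta0 : (0 < beta)%N by apply: leq_trans alphabeta.
have [K K0 lower] := queue_length_power_fun_ge R _ _ alpha0 alphabeta.
(* For [n >= 1] the power of [n] is at least [1], so the additive [2] is absorbed in the factor
   [3]. *)
rewrite qualifE; apply/asboolP; exists (K^-1, 3).
  by rewrite /= invr_gt0 K0 /=.
exists 1%N => // n /= n1; rewrite !ger0_norm ?powR_ge0//; split.
  by rewrite mulrC ler_pdivrMr// [leRHS]mulrC.
apply: (le_trans (queue_length_power_fun_le R _ _ n alpha0 beta0)).
have : 1 <= n%:R `^ (alpha%:R / beta%:R) :> R.
  rewrite -[leLHS](powRr0 (n%:R : R)) ler_powR ?ler1n// divr_ge0.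
lra.
Qed.

(** * Optimality of the exponent [1] *)

(** A bound with constant [C] would force [n ^ (t - g) <= C], which fails once [n] exceeds
    [C ^ (1 / (t - g))]. *)
Lemma natr_powR_not_bigO (R : realType) (g t : R) : g < t ->
  ~ (fun n : nat => n%:R `^ t : R) =O_\oo (fun n : nat => n%:R `^ g : R).
Proof.
move=> gt /eqO_exP[C C0 [N _ bound]].
have d0 : 0 < t - g by rewrite subr_gt0.
have [M MC] : exists M : nat, C `^ (t - g)^-1 < M%:R.
  by exists (Num.bound (C `^ (t - g)^-1)); apply: archi_boundP; exact: powR_ge0.
pose n := maxn N M.+1.
have n0 : (0 : R) < n%:R by rewrite ltr0n leq_max orbT.
have := bound n (leq_maxl _ _); rewrite !ger0_norm ?powR_ge0//.
apply/negP; rewrite -ltNge -ltr_pdivlMr ?powR_gt0//.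
rewrite -powRB ?gt_eqF ?implybT//.
have CE : C = (C `^ (t - g)^-1) `^ (t - g).
  by rewrite -powRrM mulVf ?gt_eqF// powRr1// ltW.
rewrite CE; apply: gt0_ltr_powR => //; rewrite ?nnegrE ?powR_ge0//.
by apply: (lt_le_trans MC); rewrite ler_nat leq_max leqnSn orbT.
Qed.

Lemma exists_ratio_gt (R : realType) (g : R) : g < 1 ->
  exists2 k : nat, (0 < k)%N & g < k%:R / k.+1%:R.
Proof.
move=> g1; have g10 : 0 < 1 - g by rewrite subr_gt0.
(* As [k / (k + 1) = 1 - 1 / (k + 1)], any [k] above [1 / (1 - g)] will do. *)
pose k := (Num.bound (1 - g)^-1).+1; exists k => //.
have kb : (1 - g)^-1 < k%:R.
  apply: (@lt_le_trans _ _ (Num.bound (1 - g)^-1)%:R); last by rewrite ler_nat.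
  by apply: archi_boundP; rewrite invr_ge0 ltW.
have := kb; rewrite -[(1 - g)^-1]mul1r ltr_pdivrMr// => h.
by rewrite ltr_pdivlMr ?ltr0n// -natr1; nra.
Qed.

Theorem corollary25 (R : realType) :
  (forall f : nat * nat -> rat, bimonotone f -> proper_fun f ->
     forall n : nat, (queue_length f n <= n + 1)%N) /\
  (forall gamma : R, gamma < 1 ->
     ~ (forall f : nat * nat -> rat, bimonotone f -> proper_fun f ->
          (fun n : nat => (queue_length f n)%:R : R)
            =O_\oo (fun n : nat => n%:R `^ gamma : R))) /\
  (forall alpha beta : nat, (0 < alpha)%N -> (alpha < beta)%N ->
     [/\ bimonotone (power_fun alpha beta),
         proper_fun (power_fun alpha beta) &
         (fun n : nat => (queue_length (power_fun alpha beta) n)%:R : R)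
           \is 'Theta_\oo (fun n : nat => n%:R `^ (alpha%:R / beta%:R) : R)]).
Proof.
split; first by move=> f fmon _ n; rewrite addn1; exact: queue_length_leS.
split=> [gamma gamma1 allO|alpha beta alpha0 alphabeta].
  have [k k0 gk] := exists_ratio_gt _ _ gamma1.
  have := allO _ (power_fun_bimonotone k k.+1)
               (power_fun_proper _ _ k0 (ltn0Sn k)).
  (* The lower half of the Theta bound, chained with the supposed uniform bound, would give
     [n ^ (k / (k + 1)) = O(n ^ gamma)]. *)
  have := queue_length_power_fun_Theta R _ _ k0 (ltnSn k).
  rewrite bigThetaE eqOmegaO => -[_ kO] Og.
  by apply: (natr_powR_not_bigO _ _ _ gk); exact: eqO_trans kO Og.
split; first exact: power_fun_bimonotone.
  by apply: power_fun_proper => //; exact: leq_trans alphabeta.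
exact: queue_length_power_fun_Theta.
Qed.
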